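(* Let $G=\mathrm{SL}_{n+1}$ (type $A_n$), let $P=P_I$ be a minuscule (equivalently, maximal) parabolic subgroup, let $w\in W^I$ with $w\ne1$, and let $\widehat w'=(w'_1,\ldots,w'_m)$ be the generalised reduced decomposition of $w$ obtained by Construction 1 for an arbitrary ordering of the peaks of $Q_w$. Let $\alpha$ be the unique simple root such that $(w'_1)^{-1}(\alpha)$ is a negative root. Then $$(w'_1)^{-1}(\alpha)\ \ge\ w^{-1}(\alpha).$$ Further, $(w'_1)^{-1}(\alpha)=w^{-1}(\alpha)$ if and only if $w=w'_1$, that is, $m=1$.
   Context: $G$ has maximal torus $T$ and Borel subgroup $B\supset T$, root system $R$ with positive roots $R^+$ and simple roots $S=\{\alpha_1,\ldots,\alpha_n\}$, Weyl group $W=N_G(T)/T$ with simple reflections $s_i=s_{\alpha_i}$ and length $\ell$. For characters $\lambda,\mu$ of $T$, $\lambda\ge\mu$ means that $\lambda-\mu$ is a nonnegative integral linear combination of simple roots. For $I\subset S$, $P_I$ is the parabolic subgroup generated by $B$ and representatives of $s_\alpha$, $\alpha\in I$, and $W^I=\{w\in W: w(\beta)\in R^+\ \forall\beta\in I\}$. In type $A_n$ every simple root is minuscule, and the minuscule parabolic subgroups are the maximal ones $P_{S\setminus\{\alpha_r\}}$, $1\le r\le n$. Quiver. Fix a reduced decomposition $w=s_{i_1}\cdots s_{i_k}$ and put $\beta(j)=\alpha_{i_j}$. The successor of $i\in[1,k]$ is $s(i)=\min\{j>i:\beta(j)=\beta(i)\}$ if it exists. The quiver $Q_w$ has vertex set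 $[1,k]$ and an arrow $i\to j$ if $\langle\beta(j)^\vee,\beta(i)\rangle\ne0$ and $i<j<s(i)$ (only $i<j$ if $s(i)$ does not exist). Let $\preceq_Q$ be the partial order on vertices generated by $i\preceq_Q j$ whenever there is an arrow $i\to j$. Peaks are the minimal vertices for $\preceq_Q$. (The quiver does not depend on the reduced decomposition.) Construction 1. Choose any ordering $(p_1,\ldots,p_m)$ of the set of peaks of $Q_w$. Define inductively $V_t$ as the set of vertices $v\notin V_1\cup\cdots\cup V_{t-1}$ such that $p_u\not\preceq_Q v$ for all $u>t$; let $w'_t$ be the product of the $s_{\beta(v)}$, $v\in V_t$, in increasing order of $v$. Then $w=w'_1\cdots w'_m$ and $\ell(w)=\sum_t\ell(w'_t)$; the sequence $(w'_1,\ldots,w'_m)$ is the generalised reduced decomposition obtained by Construction 1. It is known that there is exactly one simple root $\alpha$ with $(w'_1)^{-1}(\alpha)$ negative. *)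

(* Defs.v *)
From HB Require Import structures.
From mathcomp Require Import all_boot all_order all_fingroup all_algebra.
Set Implicit Arguments.
Unset Strict Implicit.
Unset Printing Implicit Defensive.
Import GRing.Theory.
Local Open Scope ring_scope.

(* Root datum of SL_{n+1}, diagonal torus T and upper triangular Borel B.
   A character of T is represented by an integer vector of its exponents, i.e.
   X(T) = Z^{n+1} / Z(1,...,1).  Roots are represented by their vectors with
   coordinate sum 0, on which the quotient map is injective; so equality and
   the order on the root lattice can be tested in Z^{n+1}.  Cocharacters are
   the vectors with coordinate sum 0, paired with characters by [pairing].
   The simple root alpha_{a+1} = eps_{a+1} - eps_{a+2} has index a : 'I_n. *)

Definition eps (n : nat) (i : 'I_n.+1) : 'rV[int]_n.+1 := delta_mx 0 i.

Definition root_vec (n : nat) (i j : 'I_n.+1) : 'rV[int]_n.+1 := eps i - eps j.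

Definition positive_root (n : nat) (v : 'rV[int]_n.+1) : bool :=
  [exists i : 'I_n.+1, exists j : 'I_n.+1, (i < j)%N && (v == root_vec i j)].

Definition negative_root (n : nat) (v : 'rV[int]_n.+1) : bool :=
  positive_root (- v).

Definition simple_root (n : nat) (a : 'I_n) : 'rV[int]_n.+1 :=
  root_vec (widen_ord (leqnSn n) a) (lift ord0 a).

Definition pairing (n : nat) (c v : 'rV[int]_n.+1) : int :=
  \sum_(i < n.+1) c 0 i * v 0 i.

(* In the coordinates above the coroot of eps_i - eps_j has the same vector. *)
Definition simple_coroot (n : nat) (a : 'I_n) : 'rV[int]_n.+1 := simple_root a.

Definition root_ge (n : nat) (lam mu : 'rV[int]_n.+1) : Prop :=
  exists c : 'I_n -> nat, lam - mu = \sum_(a < n) simple_root a *+ c a.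

(* The Weyl group is 'S_n.+1.  Since (u * v) x = v (u x) in perm.v, the LEFT
   action on characters is (w v)_j = v_{w j}, that is w eps_i = eps_{w^-1 i}:
   see weyl_actM below. *)
Definition weyl_act (n : nat) (w : 'S_n.+1) (v : 'rV[int]_n.+1) :
  'rV[int]_n.+1 := col_perm w v.

Definition simple_reflection (n : nat) (a : 'I_n) : 'S_n.+1 :=
  tperm (widen_ord (leqnSn n) a) (lift ord0 a).

Lemma weyl_actM (n : nat) (u w : 'S_n.+1) (v : 'rV[int]_n.+1) :
  weyl_act (u * w)%g v = weyl_act u (weyl_act w v).
Proof. exact: col_permM. Qed.

Lemma simple_reflectionE (n : nat) (a : 'I_n) (v : 'rV[int]_n.+1) :
  weyl_act (simple_reflection a) v
  = v - simple_root a *~ pairing (simple_coroot a) v.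
Proof.
have ne : lift ord0 a != widen_ord (leqnSn n) a.
  by rewrite -val_eqE /= /bump /= add1n neq_ltn ltnSn orbT.
have -> : pairing (simple_coroot a) v
          = v 0 (widen_ord (leqnSn n) a) - v 0 (lift ord0 a).
  rewrite /pairing (bigD1 (widen_ord (leqnSn n) a)) //= (bigD1 (lift ord0 a)) //=.
  rewrite big1 => [|i /andP [h1 h2]]; last first.
    by rewrite !mxE /= (negbTE h1) (negbTE h2) subr0 mul0r.
  rewrite !mxE /= !eqxx (negbTE ne) eq_sym (negbTE ne).
  by rewrite subr0 sub0r mul1r mulN1r addr0.
apply/matrixP => i j; rewrite ord1 /weyl_act /simple_reflection.
rewrite -scaler_int !mxE intz /= .
case: tpermP => [->|->|/eqP h1 /eqP h2].
- by rewrite eqxx eq_sym (negbTE ne) subr0 mulr1 opprB addrC subrK.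
- by rewrite eqxx (negbTE ne) sub0r mulrN1 opprK addrC subrK.
- by rewrite (negbTE h1) (negbTE h2) subr0 mulr0 subr0.
Qed.

(* I is a set of (indices of) simple roots; P_I is maximal when I misses
   exactly one simple root.  In type A these are the minuscule parabolics. *)
Definition maximal_parabolic (n : nat) (I : {set 'I_n}) : Prop :=
  exists r : 'I_n, I = [set~ r].

Definition W_upper (n : nat) (I : {set 'I_n}) : {set 'S_n.+1} :=
  [set w : 'S_n.+1 |
    [forall a in I, positive_root (weyl_act w (simple_root a))]].

(* The reduced decomposition s_{i_1} ... s_{i_k} is encoded by b : j |-> i_j,
   with positions numbered from 0. *)
Definition word_prod (n k : nat) (b : 'I_k -> 'I_n) : 'S_n.+1 :=
  (\prod_(j < k) simple_reflection (b j))%g.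

Definition reduced_decomposition (n k : nat) (w : 'S_n.+1) (b : 'I_k -> 'I_n) :
  Prop :=
  word_prod b = w /\
  forall (k' : nat) (b' : 'I_k' -> 'I_n), word_prod b' = w -> (k <= k')%N.

Section Quiver.
Variables (n k : nat) (b : 'I_k -> 'I_n).

Definition successor (i : 'I_k) : option 'I_k :=
  [pick j : 'I_k | [&& (i < j)%N, b j == b i &
     [forall l : 'I_k, ((i < l)%N && (b l == b i)) ==> (j <= l)%N]]].

Definition arrow : rel 'I_k := fun i j =>
  [&& pairing (simple_coroot (b j)) (simple_root (b i)) != 0, (i < j)%N &
      if successor i is Some l then (j < l)%N else true].

Definition quiver_le : rel 'I_k := connect arrow.

Definition peak (p : 'I_k) : bool :=
  [forall v : 'I_k, quiver_le v p ==> (v == p)].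

Definition peak_ordering (p : seq 'I_k) : bool :=
  perm_eq p (enum peak).

(* [used] is V_1 U ... U V_(t-1), and the list is (p_t, ..., p_m). *)
Fixpoint blocks_from (used : {set 'I_k}) (p : seq 'I_k) : seq {set 'I_k} :=
  if p is _ :: later then
    let V := [set v | (v \notin used) &&
                      all (fun pu => ~~ quiver_le pu v) later] in
    V :: blocks_from (used :|: V) later
  else [::].

(* The big product over 'I_k runs in increasing order. *)
Definition construction1 (p : seq 'I_k) : seq 'S_n.+1 :=
  [seq (\prod_(v < k | v \in V) simple_reflection (b v))%g
     | V : {set 'I_k} <- blocks_from set0 p].

End Quiver.

(* Main.v *)
(* The vertices of V_1 are closed under predecessors, so w = w'_1 u with lengths
   adding up, and u is again in W^I.  In the conventions of [weyl_act], x^-1 maps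
   eps_i to eps_(x i), so (w'_1)^-1(alpha) = eps_j - eps_i with i < j, and
   w^-1(alpha) = eps_(u j) - eps_(u i).  A descent of w'_1 is a descent of w,
   which forces u i <= r < u j; as u^-1 increases on [0, r] and on [r+1, n],
   u i <= i and j <= u j, which is the inequality.  If m > 1, the letter of a
   second peak is a left descent of w but not of w'_1, and this is incompatible
   with u fixing both i and j. *)
Require Import Defs.
From HB Require Import structures.
From mathcomp Require Import all_boot all_order all_fingroup all_algebra.
From mathcomp Require Import zify.
Set Implicit Arguments.
Unset Strict Implicit.
Unset Printing Implicit Defensive.
Import GRing.Theory.
Local Open Scope ring_scope.

(** * Roots as ordered pairs of indices *)

Lemma root_vec_inj (n : nat) (i j i' j' : 'I_n.+1) :
  i != j -> root_vec i j = root_vec i' j' -> i = i' /\ j = j'.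
Proof.
move=> nij /matrixP E; move: (E 0 i) (E 0 j); rewrite !mxE !eqxx /=.
rewrite (negbTE nij) (eq_sym j i) (negbTE nij).
by do 4!case: eqP => //=.
Qed.

Lemma weyl_act_root_vec (n : nat) (w : 'S_n.+1) (i j : 'I_n.+1) :
  weyl_act w (root_vec i j) = root_vec (w^-1 i)%g (w^-1 j)%g.
Proof.
apply/matrixP => x y; rewrite !mxE !ord1 !eqxx /=.
by rewrite -!(can2_eq (permK w) (permKV w)).
Qed.

Lemma positive_root_vec (n : nat) (i j : 'I_n.+1) :
  i != j -> positive_root (root_vec i j) = (i < j)%N.
Proof.
move=> nij; apply/existsP/idP => [[x /existsP [y /andP [lxy /eqP E]]]|lij].
  by have [-> ->] := root_vec_inj nij E.
by exists i; apply/existsP; exists j; rewrite lij eqxx.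
Qed.

Lemma negative_root_vec (n : nat) (i j : 'I_n.+1) :
  i != j -> negative_root (root_vec i j) = (j < i)%N.
Proof.
by move=> nij; rewrite /negative_root opprB positive_root_vec // eq_sym.
Qed.

(** * The order on the root lattice *)

Section RootLattice.
Variable n : nat.
Implicit Types (lam mu nu : 'rV[int]_n.+1) (x y : 'I_n.+1).

Lemma root_ge_trans lam mu nu :
  root_ge lam mu -> root_ge mu nu -> root_ge lam nu.
Proof.
move=> [c Ec] [d Ed]; exists (fun a => (c a + d a)%N).
rewrite -(subrKA mu) Ec Ed -big_split /=.
by apply: eq_bigr => a _; rewrite mulrnDr.
Qed.

Lemma root_geDr lam mu nu : root_ge lam mu -> root_ge (lam + nu) (mu + nu).
Proof. by move=> [c Ec]; exists c; rewrite opprD addrACA subrr addr0. Qed.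

(** The difference telescopes into the simple roots of index [x], ..., [y - 1], one per step of the
    induction. *)
Lemma eps_ge x y : (x <= y)%N -> root_ge (eps x) (eps y).
Proof.
case: x y => x hx [y hy] /=; elim: y hy => [|y IH] hy lxy.
  have <- : Ordinal hx = Ordinal hy by apply/val_inj => /=; lia.
  by exists (fun=> 0%N); rewrite subrr big1.
have [e|lt] := eqVneq x y.+1.
  have <- : Ordinal hx = Ordinal hy by apply/val_inj.
  by exists (fun=> 0%N); rewrite subrr big1.
have hy' : (y < n.+1)%N by lia.
apply: root_ge_trans (IH hy' ltac:(lia)) _.
have hyn : (y < n)%N by lia.
exists (fun a => nat_of_bool (a == Ordinal hyn)).
rewrite (bigD1 (Ordinal hyn)) //= eqxx big1 => [|a /negbTE -> //].
by rewrite addr0 /simple_root /root_vec; congr (eps _ - eps _); apply/val_inj.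
Qed.

Lemma root_vec_ge x y x' y' :
  (x <= x')%N -> (y' <= y)%N -> root_ge (root_vec x y) (root_vec x' y').
Proof.
move=> /eps_ge hx /eps_ge [c Ec].
apply: (root_ge_trans (root_geDr _ hx)).
by exists c; rewrite -Ec /root_vec opprB addrC subrKA.
Qed.

End RootLattice.

(** * Simple reflections as adjacent transpositions *)

Notation lo a := (widen_ord (leqnSn _) a).
Notation hi a := (lift ord0 a).

Lemma lo_neq_hi (n : nat) (a : 'I_n) : lo a != hi a.
Proof. by rewrite -val_eqE /= /bump /=; lia. Qed.

(** When the pairing vanishes, s_c fixes alpha_d, hence both points moved by s_d, so conjugation by
    s_c leaves s_d unchanged. *)
Lemma commute_simple_reflection (n : nat) (c d : 'I_n) :
  pairing (simple_coroot c) (simple_root d) = 0 ->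
  [/\ c != d & commute (simple_reflection c) (simple_reflection d)].
Proof.
move=> E; have := simple_reflectionE c (simple_root d).
rewrite E mulr0z subr0 weyl_act_root_vec.
have ninj : (simple_reflection c)^-1%g (lo d) != (simple_reflection c)^-1%g (hi d).
  by rewrite (inj_eq perm_inj) lo_neq_hi.
case/(root_vec_inj ninj); rewrite tpermV => El Eh; split.
  apply/eqP=> cd; move: El; rewrite cd tpermL => /eqP.
  by rewrite eq_sym (negbTE (lo_neq_hi d)).
by apply/esym; rewrite /commute conjgC tpermJ El Eh.
Qed.

(** In terms of roots: alpha_c is the only positive root that s_c makes negative. *)
Lemma simple_reflection_lt (n : nat) (c : 'I_n) (x y : 'I_n.+1) :
  (x < y)%N -> (x, y) != (lo c, hi c) ->
  (simple_reflection c x < simple_reflection c y)%N.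
Proof.
rewrite xpair_eqE -!val_eqE /= /bump /= add1n => lxy ne.
rewrite /simple_reflection; case: tpermP; case: tpermP;
  rewrite -?val_eqE => *; subst;
  repeat match goal with H : _ |- _ => move: H end;
  rewrite ?(rwP eqP) -?val_eqE /= /bump /=; lia.
Qed.

(** * Reduced words and the exchange property *)

Section Words.
Variable n : nat.
Implicit Types (s t xs ys : seq 'I_n) (c a : 'I_n) (x y : 'I_n.+1).

Definition seq_prod s : 'S_n.+1 := (\prod_(c <- s) simple_reflection c)%g.

Definition reduced s : Prop :=
  forall t, seq_prod t = seq_prod s -> (size s <= size t)%N.

Lemma seq_prod_cons c s :
  seq_prod (c :: s) = (simple_reflection c * seq_prod s)%g.
Proof. exact: big_cons. Qed.

Lemma seq_prod_cat s t : seq_prod (s ++ t) = (seq_prod s * seq_prod t)%g.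
Proof. exact: big_cat. Qed.

Lemma seq_prod_rev s : seq_prod (rev s) = (seq_prod s)^-1%g.
Proof.
elim: s => [|c s IH]; first by rewrite /seq_prod !big_nil invg1.
rewrite rev_cons -cats1 seq_prod_cat IH !seq_prod_cons invMg tpermV.
by rewrite /seq_prod big_nil mulg1.
Qed.

Lemma reduced_rev s : reduced s -> reduced (rev s).
Proof.
move=> rs t Et; rewrite size_rev -(size_rev t); apply: rs.
by rewrite seq_prod_rev Et seq_prod_rev invgK.
Qed.

(** Strong exchange. The first letter acts first; the two points are followed until a letter
    interchanges them, and that letter is deleted. Before that, the transposition is conjugated past
    each letter. *)
Lemma exchange s x y :
  (x < y)%N -> (seq_prod s y < seq_prod s x)%N ->
  exists2 t, (size t).+1 = size s & seq_prod t = (tperm x y * seq_prod s)%g.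
Proof.
elim: s x y => [|c s IH] x y lxy; first by rewrite /seq_prod big_nil !perm1; lia.
rewrite seq_prod_cons !permM => inv.
have [[-> ->]|ne] := eqVneq (x, y) (lo c, hi c).
  by exists s; rewrite // mulgA tperm2 mul1g.
have [t st Et] := IH _ _ (simple_reflection_lt lxy ne) inv.
exists (c :: t); first by rewrite /= st.
by rewrite !seq_prod_cons Et -tpermJ mulgA -conjgC mulgA.
Qed.

(** Were [a] an ascent of the whole product w, deleting a letter of [xs] would give s_a w, which has
    a descent at [a]; a second deletion would give a word for w shorter by two. *)
Lemma reduced_descent xs ys a : reduced (xs ++ ys) ->
  (seq_prod xs (hi a) < seq_prod xs (lo a))%N ->
  (seq_prod (xs ++ ys) (hi a) < seq_prod (xs ++ ys) (lo a))%N.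
Proof.
move=> red desc; have lt_a : (lo a < hi a)%N by rewrite /= /bump /=; lia.
rewrite ltnNge; apply/negP => le.
have [xs' sx Ex] := exchange lt_a desc.
have Exy : seq_prod (xs' ++ ys) = (simple_reflection a * seq_prod (xs ++ ys))%g.
  by rewrite !seq_prod_cat Ex mulgA.
have [] := @exchange (xs' ++ ys) _ _ lt_a.
  rewrite Exy !permM tpermL tpermR ltn_neqAle le andbT.
  by rewrite (inj_eq val_inj) (inj_eq perm_inj) lo_neq_hi.
move=> t st; rewrite Exy mulgA tperm2 mul1g => /red.
by move: st; rewrite !size_cat -sx; lia.
Qed.

Lemma reduced_catl xs ys : reduced (xs ++ ys) -> reduced xs.
Proof.
move=> red t Et; have := red (t ++ ys).
by rewrite !seq_prod_cat Et !size_cat leq_add2r; apply.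
Qed.

Lemma reduced_cons_ascent c s : reduced (c :: s) ->
  (seq_prod s (lo c) < seq_prod s (hi c))%N.
Proof.
move=> red; have lt_c : (lo c < hi c)%N by rewrite /= /bump /=; lia.
rewrite ltnNge leq_eqVlt (inj_eq val_inj) (inj_eq perm_inj).
rewrite eq_sym (negbTE (lo_neq_hi c)) /=; apply/negP => /(exchange lt_c) [t st Et].
by have := red t; rewrite seq_prod_cons Et /= => /(_ erefl); lia.
Qed.

End Words.

Lemma prod_partition (T : eqType) (gT : finGroupType) (F : T -> gT)
    (V : pred T) (s : seq T) :
  pairwise (fun u v => ~~ V u ==> V v ==> (F u * F v == F v * F u)%g) s ->
  (\prod_(v <- s) F v =
   \prod_(v <- s | V v) F v * \prod_(v <- s | ~~ V v) F v)%g.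
Proof.
elim: s => [|u s IH] /=; first by rewrite !big_nil mulg1.
case/andP => /allP cu /IH E; rewrite !big_cons E.
case Vu: (V u) => /=; first by rewrite mulgA.
rewrite !mulgA; congr (_ * _)%g; rewrite big_seq_cond.
apply: (big_ind (commute (F u))) => [|x y|v /andP [vs Vv]].
- exact: commute1.
- exact: commuteM.
- by have := cu v vs; rewrite Vu Vv => /eqP.
Qed.

(* [big_enum] would require a commutative law. *)
Lemma prod_enum (T : finType) (gT : finGroupType) (F : T -> gT) (P : pred T) :
  (\prod_(i <- enum T | P i) F i = \prod_(i | P i) F i)%g.
Proof. by rewrite enumT [index_enum _]unlock. Qed.

Lemma pairwise_enum_ord k : pairwise (fun i j : 'I_k => (i < j)%N) (enum 'I_k).
Proof.
rewrite -(@pairwise_map _ _ val ltn) val_enum_ord.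
by rewrite -sorted_pairwise ?iota_ltn_sorted //; apply: ltn_trans.
Qed.

(** * The heap order of a reduced word *)

Section Heap.
Variables (n k : nat) (b : 'I_k -> 'I_n).
Hypothesis red : reduced (map b (enum 'I_k)).

(** Equal letters are linked too, with pairing 2; unlinked letters commute. *)
Definition linked (u v : 'I_k) : bool :=
  pairing (simple_coroot (b v)) (simple_root (b u)) != 0.

Lemma linked_sym u v : linked u v = linked v u.
Proof. by rewrite /linked /pairing; under eq_bigr do rewrite mulrC. Qed.

(* Otherwise the two equal letters could be brought together and cancelled. *)
Lemma linked_between (u v : 'I_k) : (u < v)%N -> b u = b v ->
  exists2 m : 'I_k, (u < m < v)%N & linked u m.
Proof.
move=> luv buv.
case: (boolP [exists m : 'I_k, (u < m < v)%N && linked u m]).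
  by case/existsP => m /andP [? ?]; exists m.
rewrite negb_exists => /forallP none; exfalso.
have [s1 [t E]] : exists s1 t, enum 'I_k = s1 ++ u :: t.
  have us : u \in enum 'I_k by rewrite mem_enum.
  by case/splitPr: us => s1 t; exists s1, t.
have := pairwise_enum_ord k; rewrite E pairwise_cat /=.
case/and4P => [/allrelP s1ut _ /allP ut pt].
have : v \in enum 'I_k by rewrite mem_enum.
rewrite E mem_cat inE -val_eqE /= gtn_eqF //=.
have [/s1ut /(_ (mem_head _ _))|_ /= vt] := boolP (v \in s1); first by lia.
case/splitPr: vt E pt ut => s2 s3 E pt ut.
move: pt; rewrite pairwise_cat /= => /and3P [/allrelP s2v _ _].
have := red; rewrite E => /(_ (map b (s1 ++ s2 ++ s3))).
rewrite !map_cat /= !map_cat /= !size_cat /= !size_cat /= => redu.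
suff /redu : seq_prod (map b s1 ++ map b s2 ++ map b s3) =
  seq_prod (map b s1 ++ b u :: map b s2 ++ b v :: map b s3) by lia.
rewrite !seq_prod_cat seq_prod_cons seq_prod_cat seq_prod_cons -buv.
congr (_ * _)%g; rewrite !mulgA; congr (_ * _)%g.
suff -> : (simple_reflection (b u) * seq_prod (map b s2) =
  seq_prod (map b s2) * simple_reflection (b u))%g.
  by rewrite -mulgA tperm2 mulg1.
rewrite /seq_prod big_map big_seq.
apply: (big_ind (commute (simple_reflection (b u)))) => [|x y|m ms2].
- exact: commute1.
- exact: commuteM.
have um := ut m; rewrite mem_cat ms2 /= in um.
have mv := s2v _ _ ms2 (mem_head _ _).
have := none m; rewrite um // mv /= linked_sym negbK => /eqP.
by case/commute_simple_reflection.
Qed.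

(** Arrows from [u] stop before its successor [l]. A [v] at or after [l] is reached through [l]:
    some [m] between [u] and [l] is linked to both, and [l] has the letter of [u]. *)
Lemma quiver_le_linked (u v : 'I_k) :
  (u < v)%N -> linked u v -> quiver_le b u v.
Proof.
have [d] := ubnP (v - u); elim: d u v => // d IH u v le_d luv lk.
case E: (successor b u) => [l|]; last first.
  by apply: connect1; rewrite /arrow E luv -[_ != 0]/(linked u v) lk.
have [lvl|llv] := ltnP v l.
  by apply: connect1; rewrite /arrow E luv lvl -[_ != 0]/(linked u v) lk.
have [lul /eqP bl] : (u < l)%N /\ b l == b u.
  by move: E; rewrite /successor; case: pickP => // ? /and3P [? ? _] [<-].
have ul : quiver_le b u l.
  have [m /andP [um ml] lkm] := linked_between lul (esym bl).
  apply: connect_trans (IH _ _ _ um lkm) (IH _ _ _ ml _); try lia.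
  by rewrite linked_sym; move: lkm; rewrite /linked bl.
have [/val_inj <- //|nlv] := eqVneq (l : nat) v.
apply: connect_trans ul (IH _ _ _ _ _); try lia.
by rewrite /linked bl.
Qed.

Definition down_closed (V : {set 'I_k}) : Prop :=
  forall u v, quiver_le b u v -> v \in V -> u \in V.

(** A vertex outside [V] that stands before a vertex of [V] is not linked to it, since otherwise it
    would belong to [V]; so the two letters commute. *)
Lemma seq_prod_down_closed (V : {set 'I_k}) (s : seq 'I_k) :
  down_closed V -> pairwise (fun i j : 'I_k => (i < j)%N) s ->
  seq_prod (map b s) = seq_prod (map b [seq v <- s | v \in V] ++
                                 map b [seq v <- s | v \notin V]).
Proof.
move=> dV ps; rewrite seq_prod_cat /seq_prod !big_map !big_filter.
apply: (@prod_partition _ _ (fun v => simple_reflection (b v)) (mem V)).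
apply: sub_pairwise ps => u v luv; apply/implyP => uV; apply/implyP => vV.
have : ~~ linked v u.
  by apply: contra uV => lk; apply: dV vV; rewrite quiver_le_linked 1?linked_sym.
by rewrite negbK => /eqP /commute_simple_reflection [_ /eqP].
Qed.

(* The letter of [p] can be moved to the front of the word of [w], and then the
   letters of [V] can be moved right behind it, keeping the word reduced. *)
Lemma peak_descent (V : {set 'I_k}) (p : 'I_k) (c := b p)
    (w := seq_prod (map b (enum 'I_k)))
    (w1 := seq_prod (map b [seq v <- enum 'I_k | v \in V])) :
  down_closed V -> peak b p -> p \notin V ->
  (w (hi c) < w (lo c))%N /\ (w1 (lo c) < w1 (hi c))%N.
Proof.
move=> dV /forallP pk pV.
have dp : down_closed [set p].
  by move=> x y xy /set1P yp; have := pk x; rewrite -yp xy inE.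
set R := [seq v <- enum 'I_k | v \notin [set p]].
have pR : pairwise (fun i j : 'I_k => (i < j)%N) R.
  exact/pairwise_filter/pairwise_enum_ord.
have pE : [seq v <- enum 'I_k | v \in [set p]] = [:: p].
  rewrite (@eq_filter _ _ (pred1 p)) => [|v]; last by rewrite inE.
  apply: filter_pred1_uniq.
  - exact: enum_uniq.
  - by rewrite mem_enum.
have wE : seq_prod (c :: map b R) = w.
  by rewrite /w (seq_prod_down_closed dp (pairwise_enum_ord k)) pE.
have VR : [seq v <- R | v \in V] = [seq v <- enum 'I_k | v \in V].
  rewrite -filter_predI; apply: eq_filter => v /=.
  by rewrite !inE; case: eqP => [->|]; rewrite ?andbF ?andbT // (negbTE pV).
pose zs := map b [seq v <- R | v \notin V].
have wE' : seq_prod (c :: map b [seq v <- R | v \in V] ++ zs) = w.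
  by rewrite -wE !seq_prod_cons (seq_prod_down_closed dV pR).
(* A rearrangement of the original word has the same length. *)
have redR : reduced (c :: map b [seq v <- R | v \in V] ++ zs).
  move=> t; rewrite wE' => /red; congr (_ <= _)%N.
  rewrite -map_cat [LHS]size_map -(map_cons b) [RHS]size_map /=.
  rewrite (perm_size (permEl (perm_filterC (mem V) R))).
  rewrite -[_.+1]/(size ([:: p] ++ R)) -pE.
  exact/esym/perm_size/permEl/(perm_filterC (mem [set p])).
(* The prefix made of [c] and the letters of [V] gives the ascent of [w1]; the prefix [c] alone
   gives the descent of [w]. *)
split; last by rewrite /w1 -VR; exact/reduced_cons_ascent/(@reduced_catl _ (_ :: _) zs).
rewrite -wE' -cat1s; apply: reduced_descent; first exact: redR.
by rewrite /seq_prod big_seq1 tpermL tpermR /= /bump /=; lia.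
Qed.

End Heap.

(** Hence m is the number of peaks. *)
Lemma size_blocks_from (n k : nat) (b : 'I_k -> 'I_n) (U : {set 'I_k}) p :
  size (blocks_from b U p) = size p.
Proof. by elim: p U => //= q p IH U; rewrite IH. Qed.

(** * Maps increasing on two runs *)

Section TwoRuns.
Variables (n : nat) (r : 'I_n) (f : 'I_n.+1 -> 'I_n.+1).
(* That is, [f] increases on [0, r] and on [r+1, n]. *)
Hypothesis f_step : forall c, c != r -> (f (lo c) < f (hi c))%N.

(** Each step raises the value by at least one; the side condition avoids the step from [r] to
    [r + 1]. *)
Lemma two_runs_gap (x y : 'I_n.+1) :
  (x <= y)%N -> (y <= r)%N || (r < x)%N -> (f x + (y - x) <= f y)%N.
Proof.
case: y => y hy /=; elim: y hy => [|y IH] hy lxy side.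
  have <- : x = Ordinal hy by apply/val_inj => /=; lia.
  by lia.
have [e|ne] := eqVneq (x : nat) y.+1.
  have <- : x = Ordinal hy by apply/val_inj.
  by lia.
have hy' : (y < n.+1)%N by lia.
have hyn : (y < n)%N by lia.
have := @f_step (Ordinal hyn).
have -> : lo (Ordinal hyn) = Ordinal hy' by apply/val_inj.
have -> : hi (Ordinal hyn) = Ordinal hy by apply/val_inj.
rewrite -val_eqE /=.
by have := IH hy'; lia.
Qed.

Lemma two_runs_ge (x : 'I_n.+1) : (x <= r)%N -> (x <= f x)%N.
Proof. by move=> le; have := @two_runs_gap ord0 x (leq0n _); rewrite le /=; lia. Qed.

Lemma two_runs_le (x : 'I_n.+1) : (r < x)%N -> (f x <= x)%N.
Proof.
move=> le; have := @two_runs_gap x ord_max; rewrite le orbT /= => G.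
by have := G (leq_ord x) isT; have := leq_ord (f ord_max); have := leq_ord x; lia.
Qed.

Lemma two_runs_fix_left (x y : 'I_n.+1) : (x <= r)%N -> f x = x -> (y <= x)%N -> f y = y.
Proof.
move=> xr fx yx; have := @two_runs_gap y x yx; rewrite xr fx /= => /(_ isT).
by have := @two_runs_ge y; move=> *; apply/val_inj => /=; lia.
Qed.

Lemma two_runs_fix_right (x y : 'I_n.+1) : (r < x)%N -> f x = x -> (x <= y)%N -> f y = y.
Proof.
move=> xr fx yx; have := @two_runs_gap x y yx; rewrite xr fx orbT => /(_ isT).
by have := @two_runs_le y; move=> *; apply/val_inj => /=; lia.
Qed.

End TwoRuns.

(** * Descents of [w] and of its left factor *)

Section Factorisation.
Variables (n : nat) (r : 'I_n) (w w1 u : 'S_n.+1).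
Hypothesis w_step : forall c, c != r -> ((w^-1)%g (lo c) < (w^-1)%g (hi c))%N.
Hypothesis u_step : forall c, c != r -> ((u^-1)%g (lo c) < (u^-1)%g (hi c))%N.
Hypothesis wE : w = (w1 * u)%g.

(** [w^-1] reverses these two values, which it cannot do within one run. *)
Lemma cross_descent (a : 'I_n) :
  (w (hi a) < w (lo a))%N -> (w (hi a) <= r < w (lo a))%N.
Proof.
move=> lt; have := two_runs_gap w_step (ltnW lt); rewrite !permK /= /bump /=.
by case: (leqP (w (lo a))) => //=; case: (leqP (w (hi a))) => //= _ _ /(_ isT); lia.
Qed.

Lemma descent_spread (a : 'I_n) : (w (hi a) < w (lo a))%N ->
  (w (hi a) <= w1 (hi a))%N /\ (w1 (lo a) <= w (lo a))%N.
Proof.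
case/cross_descent/andP => lr rl; split.
- by have := two_runs_ge u_step lr; rewrite {2}wE permM permK.
- by have := two_runs_le u_step rl; rewrite {1}wE permM permK.
Qed.

(* If [u] fixed both ends, it would fix everything outside the open interval
   between them.  Say [a < c]: then [w c] lies beyond the upper end, hence
   equals [w1 c]; so [w1 (c+1)] lies there too and equals [w (c+1)], which
   should be at most [r]. *)
Lemma descent_spread_strict (a c : 'I_n) :
  (w (hi a) < w (lo a))%N -> (w1 (hi a) < w1 (lo a))%N ->
  (w (hi c) < w (lo c))%N -> (w1 (lo c) < w1 (hi c))%N ->
  root_vec (w1 (lo a)) (w1 (hi a)) <> root_vec (w (lo a)) (w (hi a)).
Proof.
move=> wa w1a wc w1c.
have nij : w1 (lo a) != w1 (hi a) by rewrite (inj_eq perm_inj) lo_neq_hi.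
case/(root_vec_inj nij) => ej ei.
have /andP [wha wla] := cross_descent wa.
have /andP [whc wlc] := cross_descent wc.
have uV x : w1 x = w x -> (u^-1)%g (w x) = w x.
  by move=> {2}<-; rewrite wE permM permK.
have fix_u (x : 'I_n.+1) : (x <= w (hi a))%N || (w (lo a) <= x)%N -> u x = x.
  move=> xij; rewrite -[x in LHS](_ : (u^-1)%g x = x) ?permKV //.
  case/orP: xij => xij.
  - exact: (two_runs_fix_left u_step wha (uV _ ei) xij).
  - exact: (two_runs_fix_right u_step wla (uV _ ej) xij).
have w1_fix x : (w x <= w (hi a))%N || (w (lo a) <= w x)%N -> w1 x = w x.
  by move=> /fix_u ux; apply: (@perm_inj _ u); rewrite ux wE permM.
have fix_w x : (w1 x <= w (hi a))%N || (w (lo a) <= w1 x)%N -> w x = w1 x.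
  by move=> /fix_u; rewrite wE permM.
have [lt_ac|lt_ca|/val_inj eac] := ltngtP a c; last by move: w1c; rewrite -eac; lia.
- have lc : (w (lo a) <= w (lo c))%N.
    rewrite leqNgt; apply/negP => lt; have := two_runs_gap w_step (ltnW lt).
    by rewrite !permK wlc orbT /= => /(_ isT); lia.
  have e1 : w1 (lo c) = w (lo c) by apply: w1_fix; rewrite lc orbT.
  rewrite e1 in w1c; move: whc; rewrite fix_w; first by lia.
  by rewrite (leq_trans lc (ltnW w1c)) orbT.
(* The mirror case: now [w1 c] falls below the lower end and equals [w c], which exceeds [r]. *)
- have hc : (w (hi c) <= w (hi a))%N.
    rewrite leqNgt; apply/negP => lt; have := two_runs_gap w_step (ltnW lt).
    by rewrite !permK whc /= /bump /= => /(_ isT); lia.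
  have e1 : w1 (hi c) = w (hi c) by apply: w1_fix; rewrite hc.
  rewrite e1 in w1c; move: wlc; rewrite fix_w; first by lia.
  by rewrite (leq_trans (ltnW w1c) hc).
Qed.

End Factorisation.

(** * From blocks of the quiver to factors of a reduced word *)

Theorem proposition4p7 (n : nat) (I : {set 'I_n}) (w : 'S_n.+1)
  (k : nat) (b : 'I_k -> 'I_n) (p : seq 'I_k) (a : 'I_n)
  (hI : maximal_parabolic I) (hw : w \in W_upper I) (hw1 : w <> 1%g)
  (hb : reduced_decomposition w b) (hp : peak_ordering b p) :
  let w' := construction1 b p in
  let w'1 := head 1%g w' in
  negative_root (weyl_act (w'1^-1)%g (simple_root a)) ->
  root_ge (weyl_act (w'1^-1)%g (simple_root a))
          (weyl_act (w^-1)%g (simple_root a)) /\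
  ((weyl_act (w'1^-1)%g (simple_root a) = weyl_act (w^-1)%g (simple_root a))
     <-> w = w'1) /\
  (w = w'1 <-> size w' = 1%N).
Proof.
move=> w' w'1; subst w'1 w'.
rewrite !weyl_act_root_vec !invgK negative_root_vec; last first.
  by rewrite (inj_eq perm_inj) lo_neq_hi.
(* Without peaks the head defaults to 1, which makes no simple root negative. *)
case: p hp => [|p1 later] hp /=; first by rewrite !perm1 /= /bump /=; lia.
set V1 := [set v | _].
set s := enum 'I_k; set w1 := (\prod_(v < k | _) _)%g.
have ps : pairwise (fun i j : 'I_k => (i < j)%N) s by exact: pairwise_enum_ord.
have sw : seq_prod (map b s) = w by rewrite /seq_prod big_map prod_enum; case: hb.
have red : reduced (map b s).
  move=> t; rewrite sw => tw; rewrite size_map size_enum_ord.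
  case: hb => _ /(_ _ (tnth (in_tuple t))); apply.
  have tE : map (tnth (in_tuple t)) (enum 'I_(size t)) = t.
    exact: (map_tnth_enum (in_tuple t)).
  rewrite -tw -[in RHS]tE.
  by rewrite /seq_prod big_map prod_enum.
set xs := map b [seq v <- s | v \in V1].
set ys := map b [seq v <- s | v \notin V1].
have sw1 : seq_prod xs = w1.
  by rewrite /seq_prod big_map big_filter prod_enum.
have dV1 : down_closed b V1.
  move=> u v uv; rewrite !inE /= => /allP vV; apply/allP => q /vV.
  by apply: contra => qu; apply: connect_trans qu uv.
have wE : seq_prod (xs ++ ys) = w.
  by rewrite -sw (seq_prod_down_closed red dV1 ps).
have redxy : reduced (xs ++ ys).
  move=> t; rewrite wE -sw => /red; congr (_ <= _)%N.
  rewrite -map_cat [LHS]size_map [RHS]size_map.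
  exact/esym/perm_size/permEl/(perm_filterC (mem V1)).
set u := seq_prod ys.
have wu : w = (w1 * u)%g by rewrite -wE seq_prod_cat sw1.
case: hI => r Ir.
have w_step c : c != r -> ((w^-1)%g (lo c) < (w^-1)%g (hi c))%N.
  move=> cr; move: hw; rewrite inE => /forallP /(_ c).
  rewrite Ir !inE cr /= weyl_act_root_vec positive_root_vec //.
  by rewrite (inj_eq perm_inj) lo_neq_hi.
(* The reversed word of [w] begins with that of [u], so a descent of [u^-1] is one of [w^-1]. *)
have u_step c : c != r -> ((u^-1)%g (lo c) < (u^-1)%g (hi c))%N.
  move=> /w_step; apply: contraTT; rewrite -!leqNgt leq_eqVlt => /orP [|].
    by rewrite (inj_eq val_inj) (inj_eq perm_inj) eq_sym (negbTE (lo_neq_hi c)).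
  have := reduced_rev redxy; rewrite rev_cat => /(@reduced_descent _ _ _ c).
  by rewrite -rev_cat !seq_prod_rev wE => h /h /ltnW.
move=> desc.
have wa : (w (hi a) < w (lo a))%N.
  by rewrite -wE; apply: reduced_descent; rewrite ?sw1.
have [le_i le_j] := descent_spread w_step u_step wu wa.
split; first exact: root_vec_ge.
have single : later = [::] -> w = w1.
  move=> l0; rewrite -sw -sw1 /xs; congr (seq_prod (map b _)).
  by apply/esym/all_filterP/allP => v _; rewrite /V1 l0 !inE.
have strict : later != [::] ->
    root_vec (w1 (lo a)) (w1 (hi a)) <> root_vec (w (lo a)) (w (hi a)).
  case El: later => [|p2 later'] // _.
  (* A later peak lies below itself, hence outside [V1]. *)
  have pV1 : p2 \notin V1 by rewrite !inE El /= /quiver_le connect0.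
  have pk : peak b p2.
    have : p2 \in enum (peak b) by rewrite -(perm_mem hp) El !inE eqxx orbT.
    by rewrite mem_enum.
  have [] := peak_descent red dV1 pk pV1; rewrite -/s sw -/xs sw1.
  exact: descent_spread_strict w_step u_step wu _ _ wa desc.
rewrite size_map size_blocks_from.
split; split.
- by move=> e; apply: single; apply/eqP; apply: contraPT e; exact: strict.
- by move=> <-.
- move=> ew; case: (later) strict => // q l /(_ isT); by rewrite -ew.
- by move=> [/size0nil].
Qed.
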